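(* Let $f:\mathbb{R}^n\to\mathbb{R}$ be a weak uniform CN function with CN form $f=[g:g_1,\dots,g_r]$, and let $(\bm x^*,\bm y^* )\in X(f)$. Define $$K_w(\bm x^*,\bm y^* )=\Big\{(\bm x,\bm y)\in\mathbb{R}^n\times\mathbb{R}^m:\ \nabla g(\bm x^*,\bm y^* )^\top[(\bm x,\bm y)-(\bm x^*,\bm y^* )]+\tfrac12[(\bm x,\bm y)-(\bm x^*,\bm y^* )]^\top B(\bm x^*,\bm y^* )[(\bm x,\bm y)-(\bm x^*,\bm y^* )]<0\Big\}.$$ If $X(\bm g)\cap K_w(\bm x^*,\bm y^* )=\emptyset$, then $(\bm x^*,\bm y^* )$ is an optimal solution to (CNP) and $\bm x^*$ is an optimal solution to (CNO).
   Context: Let $f:\mathbb{R}^n\to\mathbb{R}$ be nonconvex and let $g,g_1,\dots,g_r:\mathbb{R}^n\times\mathbb{R}^m\to\mathbb{R}$ ($r\ge1$) be convex. Put $X(\bm g)=\{(\bm x,\bm y)\in\mathbb{R}^n\times\mathbb{R}^m: g_i(\bm x,\bm y)=0,\ i=1,\dots,r\}$. The function $f$ is a CN (convertible nonconvex) function with CN form $f=[g:g_1,\dots,g_r]$ if for each $\bm x\in\mathbb{R}^n$ there is $\bm y\in\mathbb{R}^m$ with $(\bm x,\bm y)\in X(\bm g)$ and $f(\bm x)=g(\bm x,\bm y)=\min_{(\bm x,\bm y')\in X(\bm g)}g(\bm x,\bm y')$. Put $X(f)=\{(\bm x,\bm y)\in X(\bm g): f(\bm x)=g(\bm x,\bm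 y)\}$. $f$ is a weak uniform CN function if moreover $g$ is weak uniform convex: for every $(\bm x,\bm y)$ there is a positive semidefinite (symmetric) matrix $B(\bm x,\bm y)$ such that $g((\bm x,\bm y)+\bm d)-g(\bm x,\bm y)\ge\nabla g(\bm x,\bm y)^\top\bm d+\frac12\bm d^\top B(\bm x,\bm y)\bm d$ for all $\bm d\in\mathbb{R}^n\times\mathbb{R}^m$; such a $B$ is fixed. Standing assumption: $g,g_1,\dots,g_r$ are twice differentiable ($f$ need not be differentiable). (CNO): $\min f(\bm x)$ s.t. $\bm x\in\mathbb{R}^n$. (CNP): $\min g(\bm x,\bm y)$ s.t. $(\bm x,\bm y)\in\mathbb{R}^n\times\mathbb{R}^m$, $g_i(\bm x,\bm y)=0$, $i=1,\dots,r$. ''Optimal solution'' means global minimizer. *)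

(* Defs.v *)
From HB Require Import structures.
From mathcomp Require Import all_boot all_order all_algebra.
From mathcomp Require Import boolp classical_sets reals topology normedtype.
From mathcomp Require Import derive convex.

Set Implicit Arguments.
Unset Strict Implicit.
Unset Printing Implicit Defensive.

Import Order.TTheory GRing.Theory Num.Theory.
Import numFieldNormedType.Exports.

Local Open Scope classical_set_scope.
Local Open Scope ring_scope.

Definition inner (R : realType) (N : nat) (u v : 'cV[R]_N) : R :=
  (u^T *m v) 0 0.

Definition psdmx (R : realType) (N : nat) (A : 'M[R]_N) : Prop :=
  A^T = A /\ forall d : 'cV[R]_N, 0 <= inner d (A *m d).

Definition grad (R : realType) (N : nat) (g : 'cV[R]_N -> R) (z : 'cV[R]_N) :
    'cV[R]_N :=
  \col_i ('D_(delta_mx i 0) (g : 'cV[R]_N -> R^o) z : R).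

(* Totally differentiable everywhere, with an everywhere totally differentiable
   gradient; continuity of the second derivatives is not required. *)
Definition twice_differentiable (R : realType) (N : nat)
    (g : 'cV[R]_N -> R) : Prop :=
  (forall z, differentiable (g : 'cV[R]_N -> R^o) z) /\
  (forall z, differentiable (grad g) z).

Definition convex_on_space (R : realType) (N : nat)
    (g : 'cV[R]_N -> R) : Prop :=
  convex_function (E := 'cV[R]_N) [set: convex_lmodType 'cV[R]_N] g.

Definition minimizer (R : realType) (T : Type) (A : set T) (F : T -> R)
    (t : T) : Prop :=
  A t /\ forall t', A t' -> F t <= F t'.

(* A point (x, y) of R^n x R^m is the stacked column col_mx x y. *)
Section CN.
Variables (R : realType) (n m r : nat).
Implicit Types (f : 'cV[R]_n -> R) (g : 'cV[R]_(n + m) -> R).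
Implicit Types (gs : 'I_r -> 'cV[R]_(n + m) -> R).
Implicit Types (B : 'cV[R]_(n + m) -> 'M[R]_(n + m)).

Definition feasible gs : set 'cV[R]_(n + m) :=
  [set z | forall i, gs i z = 0].

Definition CN_function f g gs : Prop :=
  [/\ ~ convex_on_space f,
      convex_on_space g,
      forall i, convex_on_space (gs i) &
      forall x, exists2 y,
        minimizer [set y' | feasible gs (col_mx x y')]
                  (fun y' => g (col_mx x y')) y &
        f x = g (col_mx x y)].

Definition CN_graph f g gs : set 'cV[R]_(n + m) :=
  [set z | feasible gs z /\ f (usubmx z) = g z].

(* B is a fixed choice, z |-> B z, of the matrices whose existence defines weak
   uniform convexity. *)
Definition weak_uniform_convex g B : Prop :=
  forall z, psdmx (B z) /\
    forall d, g (z + d) - g z >= inner (grad g z) d + 2^-1 * inner d (B z *m d).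

Definition weak_uniform_CN_function f g gs B : Prop :=
  CN_function f g gs /\ weak_uniform_convex g B.

Definition Kw g B (zs : 'cV[R]_(n + m)) : set 'cV[R]_(n + m) :=
  [set z | inner (grad g zs) (z - zs) +
           2^-1 * inner (z - zs) (B zs *m (z - zs)) < 0].

End CN.

(* Main.v *)
Require Import Defs.
From mathcomp Require Import all_boot all_order all_algebra.
From mathcomp Require Import boolp classical_sets reals topology normedtype.
From mathcomp Require Import derive convex.

Import Order.TTheory GRing.Theory Num.Theory.
Import numFieldNormedType.Exports.

Local Open Scope classical_set_scope.
Local Open Scope ring_scope.

(** Let z be the given point of the CN graph, and let q be the quadratic model
    of the increment of g at z built from the gradient and B(z).  Weak uniform
    convexity says that g - g(z) >= q everywhere, and K_w is the sublevel set
    q < 0; so g is at least g(z) at every point outside K_w.  When K_w misses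
    the feasible set, z is therefore a global minimizer of the constrained
    problem ([minimizer_of_disjoint_Kw]).  The CN form then carries optimality
    down to f: each value f(x) is the value of g at some feasible point above x,
    and the value of f below z is g(z) ([minimizer_CN_of_minimizer_feasible]). *)

Lemma minimizer_of_disjoint_Kw (R : realType) (n m : nat)
    (g : 'cV[R]_(n + m) -> R) (B : 'cV[R]_(n + m) -> 'M[R]_(n + m))
    (A : set 'cV[R]_(n + m)) (zs : 'cV[R]_(n + m)) :
  weak_uniform_convex g B -> A zs -> A `&` Kw g B zs = set0 ->
  minimizer A g zs.
Proof.
move=> gB Azs AK0; split=> // z Az.
have [_ /(_ (z - zs))] := gB zs; rewrite subrKC => model_le.
rewrite -subr_ge0; apply: le_trans model_le; rewrite leNgt; apply/negP => Kz.
by have : (A `&` Kw g B zs) z by []; rewrite AK0.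
Qed.

(** Attainment of f(x) as g(x, y) at a feasible (x, y) turns a lower bound on g
    over the feasible set into a lower bound on f. *)
Lemma minimizer_CN_of_minimizer_feasible (R : realType) (n m r : nat)
    (f : 'cV[R]_n -> R) (g : 'cV[R]_(n + m) -> R)
    (gs : 'I_r -> 'cV[R]_(n + m) -> R) (zs : 'cV[R]_(n + m)) :
  CN_function f g gs -> CN_graph f g gs zs -> minimizer (feasible gs) g zs ->
  minimizer setT f (usubmx zs).
Proof.
move=> [_ _ _ fE] [_ fzs] [_ gmin]; split=> // x _.
by have [y [xy_feasible _] ->] := fE x; rewrite fzs; exact: gmin.
Qed.

Theorem theorem3p3 (R : realType) (n m r : nat) (hr : (1 <= r)%N)
    (f : 'cV[R]_n -> R) (g : 'cV[R]_(n + m) -> R)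
    (gs : 'I_r -> 'cV[R]_(n + m) -> R)
    (B : 'cV[R]_(n + m) -> 'M[R]_(n + m))
    (hg : twice_differentiable g)
    (hgs : forall i, twice_differentiable (gs i))
    (hf : weak_uniform_CN_function f g gs B)
    (xs : 'cV[R]_n) (ys : 'cV[R]_m)
    (hxys : CN_graph f g gs (col_mx xs ys))
    (hK : feasible gs `&` Kw g B (col_mx xs ys) = set0) :
  minimizer (feasible gs) g (col_mx xs ys) /\ minimizer setT f xs.
Proof.
have [fCN gB] := hf.
have zs_min := minimizer_of_disjoint_Kw R n m g B _ _ gB hxys.1 hK.
split=> //; rewrite -(col_mxKu xs ys).
exact: minimizer_CN_of_minimizer_feasible fCN hxys zs_min.
Qed.
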